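(* Let $v$ be the unique rough viscosity solution of the rough Hamilton–Jacobi–Bellman equation $$\partial_tv(t,y)+\sup_{\gamma\in\mathcal P(U)}\int_U\big[\tilde H(t,y,a,\nabla v(t,y))-\lambda\log\dot\gamma(a)\big]\dot\gamma(a)\,da+\nabla v(t,y)\cdot\sigma(t,y)\,\dot\zeta_t=0,\qquad v(T,y)=G(y).$$ For $(t,y)\in[0,T]\times\mathbb R^m$ write $\tilde H(\cdot):=\tilde H(t,y,\cdot,\nabla v(t,y)):U\to\mathbb R$. Then the feedback policy with density $$\dot\gamma^*_t(a\mid y,\nabla v(t,y))\ \propto\ \exp\Big(\tfrac1\lambda\tilde H(t,y,a,\nabla v(t,y))\Big)$$ (normalized to be a probability density on $U$) satisfies $$L^*(\tilde H)\equiv\sup_{\gamma\in\mathcal P(U)}L(\gamma,\tilde H)=L(\gamma^*_t,\tilde H),\qquad L^*(\tilde H)=\lambda\log\Big[\int_U\exp\Big(\tfrac1\lambda\tilde H(t,y,a,\nabla v(t,y))\Big)da\Big].$$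
   Context: **Rough path setting.** Fix $T>0$ and $\alpha>1/3$, and write $\delta f_{st}=f_t-f_s$. The noise $\zeta:[0,T]\to\mathbb R^d$ is $\alpha$-Hölder with $\zeta_0=0$, equipped with a Lévy area $\zeta^2$ with $|\zeta^2_{st}|\lesssim|t-s|^{2\alpha}$, $\zeta^{2;ij}_{st}-\zeta^{2;ij}_{su}-\zeta^{2;ij}_{ut}=\delta\zeta^i_{su}\delta\zeta^j_{ut}$ and $\zeta^{2;ij}_{st}+\zeta^{2;ji}_{st}=\delta\zeta^i_{st}\delta\zeta^j_{st}$. For $1/3<\kappa<\alpha$, a $\kappa$-Hölder path $z$ is weakly controlled by $\zeta$ if $\delta z_{st}=z^\zeta_s\delta\zeta_{st}+\rho_{st}$ with $z^\zeta$ $\kappa$-Hölder and $|\rho_{st}|\lesssim|t-s|^{2\kappa}$; rough integrals are $\int_s^t\mu^i_rd\zeta^i_r=\lim\sum_q[\mu^i_{t_q}\delta\zeta^i_{t_qt_{q+1}}+\mu^{\zeta;ii_1}_{t_q}\zeta^{2;i_1i}_{t_qt_{q+1}}]$ as the mesh tends to $0$. **Coefficients and reward.** $U\subset\mathbb R^d$ is a compact domain, $\mathcal P(U)$ the set of probability measures on $U$; $\dot\gamma$ denotes the Lebesgue density of $\gamma\in\mathcal P(U)$ (suprema of expressions containing $\dot\gamma$ are over measures admitting a density). $b\in\mathcal C_b^{0,1,1}([0,T]\times\mathbb R^m\times U;\mathbb R^m)$ is uniformly continuous in time and Lipschitz in space uniformly in time and control; $\sigma\in\mathcal C_b^{1,3}([0,T]\times\mathbb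 R^m;\mathbb R^{m,d})$. With $\lambda>0$, the running reward is $F(s,x,\gamma)=\int_UR(s,x,u)\dot\gamma(u)\,du-\lambda\int_U\dot\gamma(u)\log\dot\gamma(u)\,du$, assumed bounded, Lipschitz in $x$ uniformly in $\gamma\in\mathcal K$, and Lipschitz in $\gamma\in\mathcal K$, where the state space $\mathcal K\subset\mathcal P(U)$ of relaxed controls is of the form $\{\mu\in\mathcal P(U):\mu\text{ has a density }\dot\mu\ge\beta_0\}$ for a constant $\beta_0>0$; $G:\mathbb R^m\to\mathbb R$ is bounded and continuous. Set $\tilde H(t,y,a,p)=p\cdot b(t,y,a)+R(t,y,a)$ and, for measurable $h:U\to\mathbb R$, $L(\gamma,h)=\int_U[h(a)-\lambda\log\dot\gamma(a)]\dot\gamma(a)\,da$. The Hamiltonian is $H(t,y,\gamma,p)=\int_U[\tilde H(t,y,a,p)-\lambda\log\dot\gamma(a)]\dot\gamma(a)\,da$. **Rough viscosity solution.** A test function is $\psi\in\mathcal C^{\alpha,2}$ for which there is $\psi^t\in\mathcal C_b^{0,1}$ (the superscript $t$ is a label for the drift) with $\psi_{s_2}(y)-\psi_{s_1}(y)=\int_{s_1}^{s_2}\psi^t_r(y)\,dr-\int_{s_1}^{s_2}\nabla\psi_r(y)\cdot\sigma^k(r,y)\,d\zeta^k_r$ for all $y$ and $s_1\le s_2$, where $\sigma^k$ is the $k$th column of $\sigma$. A controlled path $v$ is a rough viscosity supersolution (resp. subsolution) if $v_T\ge$ (resp. $\le$) $G$ and, whenever $v-\psi$ has a local minimum (resp.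 maximum) at $(s,y)$ for a test function $\psi$, $\psi^t_s(y)\le$ (resp. $\ge$) $-\sup_\gamma H(s,y,\gamma,\nabla\psi_s(y))$; a solution is both. The equation admits a unique rough viscosity solution. $\nabla v(t,y)$ is its gradient in $y$, assumed to exist. *)

(* Defs.v *)
From HB Require Import structures.
From mathcomp Require Import all_boot all_order all_algebra.
From mathcomp Require Import lra.
From mathcomp Require Import all_classical all_reals all_analysis.

Set Implicit Arguments.
Unset Strict Implicit.
Unset Printing Implicit Defensive.

Import Order.TTheory GRing.Theory Num.Theory numFieldNormedType.Exports.

Local Open Scope classical_set_scope.
Local Open Scope ring_scope.

Section lebesgue_tuple.
Context {R : realType}.

Local Notation RR := (measurableTypeR R).

Definition tuple_cons n (p : RR * n.-tuple RR) : n.+1.-tuple RR :=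
  [tuple of p.1 :: p.2].

Lemma measurable_tuple_cons n : measurable_fun setT (@tuple_cons n).
Proof.
by apply: measurable_cons; [exact: measurable_fst|exact: measurable_snd].
Qed.

Lemma sigma_finite_pushforward_cancel d1 d2 (T1 : measurableType d1)
  (T2 : measurableType d2) (f : T1 -> T2) (g : T2 -> T1) (mu : {measure set T1 -> \bar R}) :
  measurable_fun setT g -> cancel f g -> sigma_finite setT mu ->
  sigma_finite setT (pushforward mu f).
Proof.
move=> mg fK [F FT Fm]; exists (fun k => g @^-1` F k).
  by rewrite -preimage_bigcup -FT preimage_setT.
move=> k; have [mF Fy] := Fm k; split; first by rewrite -[_ @^-1` _]setTI; exact: mg.
rewrite /pushforward (_ : f @^-1` _ = F k)//.
by apply/seteqP; split=> x /=; rewrite fK.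
Qed.

Lemma sigma_finite_prod d1 d2 (T1 : measurableType d1) (T2 : measurableType d2)
  (m1 : {sigma_finite_measure set T1 -> \bar R})
  (m2 : {sigma_finite_measure set T2 -> \bar R}) :
  sigma_finite setT (m1 \x m2)%E.
Proof.
have /sigma_finiteP[F [TF ndF Foo]] := sigma_finiteT m1.
have /sigma_finiteP[G [TG ndG Goo]] := sigma_finiteT m2.
exists (fun n => F n `*` G n).
  rewrite -setXTT TF TG predeqE => -[x y]; split.
    move=> [/= [n _ Fnx] [k _ Gky]]; exists (maxn n k) => //; split.
      by move: x Fnx; exact/subsetPset/ndF/leq_maxl.
    by move: y Gky; exact/subsetPset/ndG/leq_maxr.
  by move=> [n _ []/= ? ?]; split; exists n.
move=> k; have [? ?] := Foo k; have [? ?] := Goo k.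
split; first exact: measurableX.
by rewrite product_measure1E// lte_mul_pinfty// ge0_fin_numE.
Qed.

Definition lebesgue_cons n
    (mu : {sigma_finite_measure set n.-tuple RR -> \bar R}) :
    set (n.+1.-tuple RR) -> \bar R :=
  pushforward (lebesgue_measure \x mu)%E (@tuple_cons n).

Section lebesgue_cons_instances.
Variables (n : nat) (mu : {sigma_finite_measure set n.-tuple RR -> \bar R}).

Let nu : {measure set _ -> \bar R} :=
  @measure_function_pushforward__canonical__measure_function_Measure _ _ _ _ _
    (lebesgue_measure \x mu)%E _ (@measurable_tuple_cons n).
HB.instance Definition _ := isMeasure.Build _ _ _ (lebesgue_cons mu)
  (measure0 nu) (measure_ge0 nu) (@measure_semi_sigma_additive _ _ _ nu).

Lemma lebesgue_cons_sigma_finite : sigma_finite setT (lebesgue_cons mu).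
Proof.
have h := sigma_finite_prod (@lebesgue_measure R) mu.
apply: (@sigma_finite_pushforward_cancel _ _ _ _ _
  (fun t : n.+1.-tuple RR => (thead t, [tuple of behead t]))).
- apply/measurable_fun_pairP; split.
    exact: measurable_tnth.
  exact: measurable_behead.
- by case=> x t; congr pair; apply/val_inj.
- exact: h.
Qed.

HB.instance Definition _ := Measure_isSigmaFinite.Build _ _ _
  (lebesgue_cons mu) lebesgue_cons_sigma_finite.

End lebesgue_cons_instances.


Fixpoint lebesgue_tuple n :
    {sigma_finite_measure set n.-tuple RR -> \bar R} :=
  match n with
  | 0%N => \d_([tuple] : 0.-tuple RR)
  | n'.+1 => lebesgue_cons (lebesgue_tuple n')
  end.
End lebesgue_tuple.

Section borel.
Context {R : realType}.
Local Notation RR := (measurableTypeR R).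

(* R^d with its Borel sigma-algebra *)
Definition borelV d := g_sigma_algebraType (@open 'rV[R]_d).
HB.instance Definition _ d := Measurable.on (borelV d).

Definition row_of_tuple d (t : d.-tuple RR) : borelV d :=
  \row_i tnth t i.

Definition tuple_of_row d (x : borelV d) : d.-tuple RR :=
  [tuple (x : 'rV[R]_d) 0 i | i < d].

Lemma row_of_tupleK d : cancel (@row_of_tuple d) (@tuple_of_row d).
Proof. by move=> t; apply: eq_from_tnth => i; rewrite tnth_mktuple mxE. Qed.

Lemma measurable_row_of_tuple d : measurable_fun setT (@row_of_tuple d).
Proof.
apply: (@measurability _ _ _ (borelV d) setT (@row_of_tuple d) (@open 'rV[R]_d) erefl) => // _ [V oV <-]; rewrite setTI.
pose B (q : {ffun 'I_d -> rat * rat}) : set (d.-tuple RR) :=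
  \big[setI/setT]_(i < d) (@tnth d R ^~ i @^-1` `]ratr (q i).1, ratr (q i).2[%classic).
have BP q t : B q t <-> forall i, ratr (q i).1 < tnth t i < ratr (q i).2.
  rewrite /B -bigcap_seq; split=> [+ i|tq i _].
    by move/(_ i); rewrite /= mem_index_enum in_itv; exact.
  by rewrite /= in_itv; exact: tq.
have mB q : measurable (B q).
  apply: big_ind => //; first exact: measurableI.
  by move=> i _; rewrite -[X in measurable X]setTI; exact: measurable_tnth.
rewrite (_ : _ @^-1` V = \bigcup_q
  (if pselect (B q `<=` @row_of_tuple d @^-1` V) then B q else set0)); last first.
  apply/seteqP; split => [t /= Ot|t [q _]]; last first.
    by case: pselect => //= sB Bt; exact: sB.
  have [e /= e0 xeV] : exists2 e : R, 0 < e & ball (row_of_tuple t : 'rV[R]_d) e `<=` V.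
    have /nbhs_ballP[e e0 eV] := open_nbhs_nbhs (conj oV Ot).
    by exists e.
  have /choice[q qP] (i : 'I_d) : exists q : rat * rat,
      [/\ tnth t i - e < ratr q.1, ratr q.1 < tnth t i,
          tnth t i < ratr q.2 & ratr q.2 < tnth t i + e].
    have /rat_in_itvoo[q1] : tnth t i - e < tnth t i by rewrite ltrBlDr ltrDl.
    have /rat_in_itvoo[q2] : tnth t i < tnth t i + e by rewrite ltrDl.
    rewrite !in_itv/= => /andP[? ?] /andP[? ?].
    by exists (q1, q2).
  exists [ffun i => q i] => //; case: pselect => [sB|[]] /=.
    by apply/BP => i; rewrite ffunE; have [_ -> -> _] := qP i.
  move=> s /BP sP /=; apply: xeV; split=> // j i; rewrite !mxE.
  have := sP i; rewrite ffunE => /andP[s1 s2]; have [t1 t2 t3 t4] := qP i.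
  rewrite /ball/= ltr_norml; apply/andP; split; lra.
apply: countable_bigcupT_measurable => // q.
by case: pselect => sB; [exact: mB|exact: measurable0].
Qed.

Lemma measurable_tuple_of_row d : measurable_fun setT (@tuple_of_row d).
Proof.
apply/measurable_fun_tnthP => i.
rewrite (_ : _ \o _ = (fun x : borelV d => (x : 'rV[R]_d) 0 i)); last first.
  by apply/funext => x /=; rewrite tnth_mktuple.
apply: (@measurability _ _ _ _ _ _ _ (@measurable_realfun.RGenOpens.measurableE R)) => // _ [_ [a [b ->]] <-].
rewrite setTI; apply: sub_sigma_algebra => /=.
have /continuousP := @coord_continuous R 1 d 0 i; apply.
exact: interval_open.
Qed.

Definition lebesgue_row d : set (borelV d) -> \bar R :=
  pushforward (lebesgue_tuple d) (@row_of_tuple d).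

Section lebesgue_row_instances.
Variable d : nat.

Let nu : {measure set (borelV d) -> \bar R} :=
  @measure_function_pushforward__canonical__measure_function_Measure _ _ _ _ _
    (@lebesgue_tuple R d) _ (@measurable_row_of_tuple d).

HB.instance Definition _ := isMeasure.Build _ _ _ (@lebesgue_row d)
  (measure0 nu) (measure_ge0 nu) (@measure_semi_sigma_additive _ _ _ nu).

Lemma lebesgue_row_sigma_finite : sigma_finite setT (@lebesgue_row d).
Proof.
apply: (@sigma_finite_pushforward_cancel _ _ _ _ _ _ (@tuple_of_row d)).
- exact: measurable_tuple_of_row.
- exact: row_of_tupleK.
- exact: sigma_finiteT.
Qed.

HB.instance Definition _ := Measure_isSigmaFinite.Build _ _ _ (@lebesgue_row d)
  lebesgue_row_sigma_finite.

End lebesgue_row_instances.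

End borel.
Arguments borelV : clear implicits.
Arguments lebesgue_row : clear implicits.

Section rough_paths.
Context {R : realType} {d : nat}.
Variable T : R.
Implicit Types (a kappa : R) (zeta : R -> 'rV[R]_d).

Definition holder (V : normedZmodType R) a (f : R -> V) : Prop :=
  exists C : R, forall s t, s \in `[0, T] -> t \in `[0, T] ->
    `|f t - f s| <= C * `|t - s| `^ a.

Definition levy_area a zeta (zeta2 : R -> R -> 'M[R]_d) : Prop :=
  [/\ exists C : R, forall s t, 0 <= s -> s <= t -> t <= T ->
        `|zeta2 s t| <= C * `|t - s| `^ (2 * a),
      forall s u t, 0 <= s -> s <= u -> u <= t -> t <= T -> forall i j,
        zeta2 s t i j - zeta2 s u i j - zeta2 u t i j =
        (zeta u - zeta s) 0 i * (zeta t - zeta u) 0 j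
    & forall s t, 0 <= s -> s <= t -> t <= T -> forall i j,
        zeta2 s t i j + zeta2 s t j i =
        (zeta t - zeta s) 0 i * (zeta t - zeta s) 0 j].

Definition rough_noise a zeta (zeta2 : R -> R -> 'M[R]_d) : Prop :=
  [/\ zeta 0 = 0, holder a zeta & levy_area a zeta zeta2].

Definition controlled kappa zeta (z : R -> R) (z' : R -> 'rV[R]_d) : Prop :=
  [/\ holder kappa z, holder kappa z'
    & exists C : R, forall s t, 0 <= s -> s <= t -> t <= T ->
        `|z t - z s - \sum_i z' s 0 i * (zeta t - zeta s) 0 i|
          <= C * `|t - s| `^ (2 * kappa)].

(* compensated Riemann sum along p 0 <= ... <= p n; mu' t i j is the
   derivative of the i-th component of mu in the direction zeta^j *)
Definition rough_sum zeta (zeta2 : R -> R -> 'M[R]_d)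
    (mu : R -> 'rV[R]_d) (mu' : R -> 'M[R]_d)
    (n : nat) (p : nat -> R) : R :=
  \sum_(0 <= q < n)
    (\sum_i mu (p q) 0 i * (zeta (p q.+1) - zeta (p q)) 0 i +
     \sum_i \sum_j mu' (p q) i j * zeta2 (p q) (p q.+1) j i).

Definition is_rough_integral zeta (zeta2 : R -> R -> 'M[R]_d)
    (mu : R -> 'rV[R]_d) (mu' : R -> 'M[R]_d) (s t I : R) : Prop :=
  forall eps : R, 0 < eps -> exists2 eta : R, 0 < eta &
    forall (n : nat) (p : nat -> R), p 0%N = s -> p n = t ->
      (forall q, (q < n)%N -> p q <= p q.+1 /\ p q.+1 - p q < eta) ->
      `|rough_sum zeta zeta2 mu mu' n p - I| < eps.

End rough_paths.

Section regularity.
Context {R : realType} {m d : nat}.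
Variable T : R.
Implicit Types (f : R -> 'rV[R]_m -> R) (U : set 'rV[R]_d).

Definition grad (g : 'rV[R]_m -> R) (y : 'rV[R]_m) : 'rV[R]_m :=
  \row_i 'D_(delta_mx 0 i) g y.

Definition partials (l : seq 'I_m) (g : 'rV[R]_m -> R) : 'rV[R]_m -> R :=
  foldr (fun i (h : 'rV[R]_m -> R) y => 'D_(delta_mx 0 i) h y) g l.

Definition strip : set (R * 'rV[R]_m) := [set p | p.1 \in `[0, T]].

Definition continuous_strip f : Prop :=
  {within strip, continuous (fun p => f p.1 p.2)}.

Definition bounded_strip f : Prop :=
  exists C : R, forall t y, t \in `[0, T] -> `|f t y| <= C.

(* regularity classes C^{0,k}, C_b^{0,k}, C_b^{1,k}, C^{a,k} in (time, space) on
   [0, T] x R^m *)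
Definition C_0k (k : nat) f : Prop :=
  (forall l i t y, (size l < k)%N -> t \in `[0, T] ->
     derivable (partials l (f t)) y (delta_mx 0 i)) /\
  (forall l, (size l <= k)%N -> continuous_strip (fun t => partials l (f t))).

Definition Cb_0k (k : nat) f : Prop :=
  C_0k k f /\
  forall l, (size l <= k)%N -> bounded_strip (fun t => partials l (f t)).

(* the time derivative is one-sided at 0 and T *)
Definition Cb_1k (k : nat) f : Prop :=
  Cb_0k k f /\
  exists f' : R -> 'rV[R]_m -> R,
    [/\ continuous_strip f', bounded_strip f'
      & forall t y, t \in `[0, T] ->
          (f s y - f t y) / (s - t)
            @[s --> within [set s | s \in `[0, T]] t^'] --> f' t y].

Definition C_alphak (a : R) (k : nat) f : Prop :=
  C_0k k f /\ forall y, holder T a (f ^~ y).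

Definition slab U : set (R * 'rV[R]_m * 'rV[R]_d) :=
  [set p | p.1.1 \in `[0, T] /\ U p.2].

Definition Cb_slab U (f : R -> 'rV[R]_m -> 'rV[R]_d -> R) : Prop :=
  {within slab U, continuous (fun p => f p.1.1 p.1.2 p.2)} /\
  exists C : R, forall t x u, t \in `[0, T] -> U u -> `|f t x u| <= C.

(* differentiability in the control is asked in the interior of U, with
   derivatives extending continuously to U *)
Definition Cb_011 U (f : R -> 'rV[R]_m -> 'rV[R]_d -> R) : Prop :=
  [/\ Cb_slab U f,
      forall i,
        (forall t x u, t \in `[0, T] -> U u ->
           derivable (f t ^~ u) x (delta_mx 0 i)) /\
        Cb_slab U (fun t x u => 'D_(delta_mx 0 i) (f t ^~ u) x)
    & forall j, exists2 g, Cb_slab U g &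
        forall t x u, t \in `[0, T] -> U° u ->
          is_derive u (delta_mx 0 j) (f t x) (g t x u)].

End regularity.

Section relaxed_controls.
Context {R : realType} {d : nat}.
Variable U : set 'rV[R]_d.
Local Notation leb := (lebesgue_row R d).
Implicit Types (gamma : probability (borelV R d) R) (h : 'rV[R]_d -> R).

Definition compact_domain : Prop :=
  compact U /\
  exists O : set 'rV[R]_d, [/\ open O, connected O, O !=set0 & U = closure O].

Definition PU : set (probability (borelV R d) R) :=
  [set gamma | gamma U = 1%E].

Definition has_density gamma (g : borelV R d -> R) : Prop :=
  [/\ measurable_fun (U : set (borelV R d)) g,
      forall a, U a -> 0 <= g a
    & forall A : set (borelV R d), measurable A ->
        gamma A = (\int[leb]_(a in A `&` U) (g a)%:E)%E].

(* the density of gamma, defined up to a null set *)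
Definition density gamma : borelV R d -> R :=
  xget (cst 0) [set g | has_density gamma g].

Definition PU_ac : set (probability (borelV R d) R) :=
  [set gamma | PU gamma /\ exists g, has_density gamma g].

Definition PU_ge (beta0 : R) : set (probability (borelV R d) R) :=
  [set gamma | PU gamma /\
     exists2 g, has_density gamma g & forall a, U a -> beta0 <= g a].

Definition is_metric_on (K : set (probability (borelV R d) R))
    (dK : probability (borelV R d) R -> probability (borelV R d) R -> R) :
    Prop :=
  [/\ forall g1 g2, K g1 -> K g2 -> 0 <= dK g1 g2,
      forall g1 g2, K g1 -> K g2 ->
        (dK g1 g2 = 0 <-> forall A, measurable A -> g1 A = g2 A),
      forall g1 g2, K g1 -> K g2 -> dK g1 g2 = dK g2 g1
    & forall g1 g2 g3, K g1 -> K g2 -> K g3 ->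
        dK g1 g3 <= dK g1 g2 + dK g2 g3].

Variable lambda : R.

(* L(gamma, h) and its supremum; values are in \bar R because the entropy of gamma may be infinite;
   0 log 0 = 0 holds as ln 0 = 0 in the library *)
Definition entropic_reward gamma h : \bar R :=
  (\int[leb]_(a in U)
     ((h a - lambda * ln (density gamma a)) * density gamma a)%:E)%E.

Definition opt_entropic_reward h : \bar R := ereal_sup [set entropic_reward gamma h | gamma in PU_ac].

Definition gibbs h (a : borelV R d) : R :=
  expR (lambda^-1 * h a) / \int[leb]_(a' in U) expR (lambda^-1 * h a').

End relaxed_controls.

Section control_problem.
Context {R : realType} {m d : nat}.
Variables (T : R) (U : set 'rV[R]_d) (lambda : R).
Variables (b : R -> 'rV[R]_m -> 'rV[R]_d -> 'rV[R]_m).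
Variables (sigma : R -> 'rV[R]_m -> 'M[R]_(m, d)).
Variables (rew : R -> 'rV[R]_m -> 'rV[R]_d -> R) (G : 'rV[R]_m -> R).
Variables (alpha kappa : R).
Variables (zeta : R -> 'rV[R]_d) (zeta2 : R -> R -> 'M[R]_d).
Local Notation leb := (lebesgue_row R d).
Implicit Types (gamma : probability (borelV R d) R) (p y : 'rV[R]_m).

Definition drift_assumption : Prop :=
  [/\ forall i, Cb_011 T U (fun t x u => b t x u 0 i),
      forall eps : R, 0 < eps -> exists2 eta : R, 0 < eta &
        forall s t x u, s \in `[0, T] -> t \in `[0, T] -> U u ->
          `|t - s| < eta -> `|b t x u - b s x u| < eps
    & exists C : R, forall t x x' u, t \in `[0, T] -> U u ->
        `|b t x u - b t x' u| <= C * `|x - x'|].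

Definition diffusion_assumption : Prop :=
  forall i j, Cb_1k T 3 (fun t x => sigma t x i j).

Definition running_reward (s : R) (x : 'rV[R]_m) gamma : \bar R :=
  (\int[leb]_(u in U) (rew s x u * density U gamma u)%:E
   - lambda%:E *
     \int[leb]_(u in U) (density U gamma u * ln (density U gamma u))%:E)%E.

(* K is a set of controls whose densities are bounded below; it is not taken to
   be all of PU_ge, where the entropy is unbounded. dK is the metric on K. *)
Definition reward_assumption (K : set (probability (borelV R d) R))
    (dK : probability (borelV R d) R -> probability (borelV R d) R -> R) :
    Prop :=
  [/\ exists C : R, forall s x gamma, s \in `[0, T] -> K gamma ->
        (`|running_reward s x gamma| <= C%:E)%E,
      exists C : R, forall s x x' gamma, s \in `[0, T] -> K gamma ->
        (`|running_reward s x gamma - running_reward s x' gamma|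
           <= (C * `|x - x'|)%:E)%E
    & exists C : R, forall s x gamma gamma', s \in `[0, T] ->
        K gamma -> K gamma' ->
        (`|running_reward s x gamma - running_reward s x gamma'|
           <= (C * dK gamma gamma')%:E)%E].

(* the condition under which exp (Htilde / lambda) has a finite integral over U
   and can be normalized, b being bounded; it holds for bounded rew *)
Definition normalizable_reward : Prop :=
  forall t y, t \in `[0, T] ->
    measurable_fun (U : set (borelV R d)) (rew t y : borelV R d -> R) /\
    (\int[leb]_(a in U) (expR (lambda^-1 * rew t y a))%:E < +oo)%E.

Definition terminal_assumption : Prop :=
  continuous G /\ exists C : R, forall y, `|G y| <= C.

Definition Htilde (t : R) y (a : 'rV[R]_d) p : R :=
  \sum_i p 0 i * b t y a 0 i + rew t y a.

Definition Hamiltonian (t : R) y gamma p : \bar R :=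
  (\int[leb]_(a in U)
     ((Htilde t y a p - lambda * ln (density U gamma a))
      * density U gamma a)%:E)%E.

Definition sup_Hamiltonian (t : R) y p : \bar R :=
  ereal_sup [set Hamiltonian t y gamma p | gamma in PU_ac U].

(* the row (grad psi . sigma^k)_k integrated against zeta *)
Definition transport_term (psi : R -> 'rV[R]_m -> R) y (r : R) : 'rV[R]_d :=
  grad (psi r) y *m sigma r y.

(* derivative of transport_term along zeta: as the increments of psi are
   - (grad psi . sigma^l) dzeta^l to first order, that of
   grad psi . sigma^k is - grad (grad psi . sigma^l) . sigma^k *)
Definition transport_term' (psi : R -> 'rV[R]_m -> R) y (r : R) : 'M[R]_d :=
  \matrix_(k, l)
    - (grad (fun z => transport_term psi z r 0 l) y *m sigma r y) 0 k.

Definition test_function (psi psit : R -> 'rV[R]_m -> R) : Prop :=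
  [/\ C_alphak T alpha 2 psi,
      Cb_0k T 1 psit,
      forall y k, controlled T kappa zeta
        (fun r => transport_term psi y r 0 k)
        (fun r => row k (transport_term' psi y r))
    & forall y s1 s2, 0 <= s1 -> s1 <= s2 -> s2 <= T ->
        exists2 I : R,
          is_rough_integral zeta zeta2
            (transport_term psi y) (transport_term' psi y) s1 s2 I &
          psi s2 y - psi s1 y =
            \int[lebesgue_measure]_(r in `[s1, s2]) psit r y - I].

Definition local_min_at (f : R -> 'rV[R]_m -> R) (s : R) y : Prop :=
  \forall q \near ((s, y) : R * 'rV[R]_m), f s y <= f q.1 q.2.

Definition local_max_at (f : R -> 'rV[R]_m -> R) (s : R) y : Prop :=
  \forall q \near ((s, y) : R * 'rV[R]_m), f q.1 q.2 <= f s y.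

(* paths of continuous functions; without joint continuity uniqueness fails
   already for the trivial equation *)
Definition controlled_field (v : R -> 'rV[R]_m -> R) : Prop :=
  continuous_strip T v /\
  forall y, exists v' : R -> 'rV[R]_d, controlled T kappa zeta (v ^~ y) v'.

(* s ranges over the open interval: at s = T, adding a steep linear function of
   time to psi would rule out every supersolution *)
Definition rough_supersolution (v : R -> 'rV[R]_m -> R) : Prop :=
  [/\ controlled_field v, forall y, G y <= v T y
    & forall psi psit, test_function psi psit ->
        forall s y, 0 < s < T ->
        local_min_at (fun t x => v t x - psi t x) s y ->
        ((psit s y)%:E <= - sup_Hamiltonian s y (grad (psi s) y))%E].

Definition rough_subsolution (v : R -> 'rV[R]_m -> R) : Prop :=
  [/\ controlled_field v, forall y, v T y <= G y
    & forall psi psit, test_function psi psit ->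
        forall s y, 0 < s < T ->
        local_max_at (fun t x => v t x - psi t x) s y ->
        (- sup_Hamiltonian s y (grad (psi s) y) <= (psit s y)%:E)%E].

Definition rough_viscosity_solution (v : R -> 'rV[R]_m -> R) : Prop :=
  rough_supersolution v /\ rough_subsolution v.

Definition unique_rough_viscosity_solution (v : R -> 'rV[R]_m -> R) : Prop :=
  rough_viscosity_solution v /\
  forall w, rough_viscosity_solution w ->
    forall t y, t \in `[0, T] -> w t y = v t y.

End control_problem.

(* Main.v *)
Require Import Defs.
From HB Require Import structures.
From mathcomp Require Import all_boot all_order all_algebra.
From mathcomp Require Import ring lra.
From mathcomp Require Import all_classical all_reals all_analysis.
From mathcomp Require Import measurable_realfun.

Set Implicit Arguments.
Unset Strict Implicit.
Unset Printing Implicit Defensive.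

Import Order.TTheory GRing.Theory Num.Theory numFieldNormedType.Exports.

Local Open Scope classical_set_scope.
Local Open Scope ring_scope.

(** The statement is the Gibbs variational principle, applied at each [(t, y)]
to the function [h = Htilde t y . (grad v)] on [U].  Write
[w = exp (h / lambda)], [Z] for its integral over [U] and [q = w / Z].  Then
[h = lambda ln q + lambda ln Z], so that for every density [g]

  [(h - lambda ln g) g = lambda ln Z * g - lambda g ln (g / q)].

The last term integrates to [lambda] times the relative entropy of [g] with
respect to [q]: it is nonnegative and vanishes for [g = q].  Hence the supremum
of [L (gamma, h)] is [lambda ln Z] and is attained at the Gibbs density.

Since the entropy of [g] may be infinite, the relative entropy is not handled
as a difference of integrals.  The inequality [ln x <= x - 1] at [x = q / g]
gives instead a pointwise upper bound by the integrable function
[lambda q + lambda (ln Z - 1) g] ([le_gibbs_density]), whose integral is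
[lambda ln Z] ([entropic_integral_le]).

Three further facts are needed.  First, [0 < Z < +oo]: [U] contains a nonempty
open set, which has positive Lebesgue measure since it contains a box
([lebesgue_row_open_gt0]), and the drift is bounded while [exp (rew / lambda)]
is integrable ([integrable_exp_Htilde]).  Secondly, [q] is the density of an
actual probability measure ([exists_gibbs_control]).  Thirdly, the reward is
defined through a chosen version of the density, so one has to know that
densities are almost everywhere unique ([has_density_ae_eq],
[entropic_rewardE]). *)

(** * Integrals over a measure space *)

Section integration.
Context d (X : measurableType d) (R : realType).
Variables (mu : {measure set X -> \bar R}) (D : set X).
Hypothesis mD : measurable D.
Local Open Scope ereal_scope.

(** If the integral vanished, so would [f] almost everywhere on [D], and [D]
would be a null set. *)
Lemma integral_gt0 (f : X -> \bar R) :
  measurable_fun D f -> (forall x, D x -> 0 < f x) -> 0 < mu D ->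
  0 < \int[mu]_(x in D) f x.
Proof.
move=> mf f0 D0.
have f0' x : D x -> 0 <= f x by move=> /f0/ltW.
rewrite lt0e integral_ge0// andbT; apply/eqP => if0.
have /(ae_eq_integral_abs mu mD mf) [N [mN N0 DN]] :
    \int[mu]_(x in D) `|f x| = 0.
  by rewrite -if0; apply: eq_integral => x /[1!inE] Dx; rewrite gee0_abs ?f0'.
have : mu D <= mu N.
  apply: le_measure; rewrite ?inE// => x Dx; apply: DN => /= /(_ Dx) fx0.
  by have := f0 x Dx; rewrite fx0 ltxx.
by rewrite N0 leNgt D0.
Qed.

(** Monotonicity when only the upper bound is integrable: the integral of [f]
may be [-oo], as happens for a density of infinite entropy. *)
Lemma le_integral_integrable_ub (f g : X -> \bar R) :
  measurable_fun D f -> mu.-integrable D g ->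
  (forall x, D x -> f x <= g x) ->
  \int[mu]_(x in D) f x <= \int[mu]_(x in D) g x.
Proof.
move=> mf /integrableP[mg _] fg.
have fg' : {in D, forall x, f x <= g x} by move=> x /[1!inE]; exact: fg.
rewrite integralE [leRHS]integralE leeB//; apply: ge0_le_integral => //.
- exact: measurable_funepos.
- exact: measurable_funepos.
- by move=> x /mem_set; exact: funepos_le.
- exact: measurable_funeneg.
- exact: measurable_funeneg.
- by move=> x /mem_set; exact: funeneg_le.
Qed.

(** Countable additivity of [A |-> \int_(A `&` D) q] is that of the integral of
a nonnegative function in its domain. *)
Lemma exists_probability_density (q : X -> R) :
  measurable_fun D q -> (forall x, D x -> (0 <= q x)%R) ->
  \int[mu]_(x in D) (q x)%:E = 1 ->
  exists P : probability X R,
    forall A, measurable A -> P A = \int[mu]_(x in A `&` D) (q x)%:E.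
Proof.
move=> mq q0 q1.
pose P A := \int[mu]_(x in A `&` D) (q x)%:E.
have P0 : P set0 = 0 by rewrite /P set0I integral_set0.
have P_ge0 A : 0 <= P A by apply: integral_ge0 => x [_ Dx]; rewrite lee_fin q0.
have P_sigma : semi_sigma_additive P.
  move=> F mF tF mUF; rewrite /P setI_bigcupl ge0_integral_bigcup//.
  - apply: is_cvg_ereal_nneg_natsum_cond => n _ _; exact: P_ge0.
  - by move=> k; exact: measurableI.
  - apply/measurable_EFinP; apply: measurable_funS mq => //.
    by move=> x [k _ []].
  - by move=> x [k _ [_ /q0]]; rewrite lee_fin.
  - exact: trivIset_setIr.
pose mP := isMeasure.Build _ _ _ P P0 P_ge0 P_sigma.
pose Pm : {measure set X -> \bar R} := HB.pack P mP.
have Pm1 : Pm setT = 1 by rewrite -q1 /Pm /= /P setTI.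
pose pP := Measure_isProbability.Build _ _ _ Pm Pm1.
pose Pp : probability X R := HB.pack P mP pP.
by exists Pp.
Qed.

End integration.

(** * The Gibbs variational principle *)

Section gibbs_variational_principle.
Context d (X : measurableType d) (R : realType).
Variables (mu : {measure set X -> \bar R}) (D : set X) (lambda : R) (h : X -> R).
Hypotheses (mD : measurable D) (lambda_gt0 : 0 < lambda).
Hypothesis mh : measurable_fun D h.

Let w a := expR (lambda^-1 * h a).
Let Z := \int[mu]_(a in D) w a.
Let q a := w a / Z.

Hypothesis w_int : mu.-integrable D (EFin \o w).
Hypothesis Z_gt0 : 0 < Z.

Lemma measurable_gibbs_density : measurable_fun D q.
Proof.
apply: measurable_funM => //.
by apply: measurableT_comp => //; exact: measurable_funM.
Qed.

Lemma gibbs_density_gt0 a : 0 < q a.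
Proof. by rewrite divr_gt0// expR_gt0. Qed.

Lemma integrable_gibbs_density : mu.-integrable D (EFin \o q).
Proof.
rewrite (_ : EFin \o q = (fun a => (Z^-1)%:E * (w a)%:E)%E).
  exact: integrableZl.
by apply/funext => a /=; rewrite -EFinM mulrC.
Qed.

Lemma integral_gibbs_density : (\int[mu]_(a in D) (q a)%:E = 1)%E.
Proof.
have <- : \int[mu]_(a in D) q a = 1.
  by rewrite RintegralZr// -/Z divff ?gt_eqF.
rewrite fineK//.
by apply: integrable_fin_num => //; exact: integrable_gibbs_density.
Qed.

(** For [g > 0] this is [ln (q / g) <= q / g - 1] multiplied by [lambda g], with
[ln q = h / lambda - ln Z].  Unlike the relative entropy itself, the right-hand
side is integrable for every density [g]. *)
Lemma le_gibbs_density (a : X) (g : R) : 0 <= g ->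
  (h a - lambda * ln g) * g <= lambda * q a + lambda * (ln Z - 1) * g.
Proof.
rewrite le_eqVlt => /predU1P[<-|g0].
  (* at g = 0 the left-hand side is 0, whatever the value of ln 0 *)
  by rewrite !mulr0 addr0 mulr_ge0// ltW// gibbs_density_gt0.
have qg0 : 0 < q a / g by rewrite divr_gt0// gibbs_density_gt0.
have : ln (q a / g) <= q a / g - 1.
  by rewrite -[in leLHS](subrKC 1 (q a / g)) le_ln1Dx// ltrBrDl subrr.
rewrite ln_div ?posrE ?gibbs_density_gt0//.
rewrite ln_div ?posrE ?expR_gt0// expRK lerBrDl => H.
have := ler_wpM2l (ltW (mulr_gt0 lambda_gt0 g0)) H.
have -> : lambda * g * (q a / g) = lambda * q a.
  by field; rewrite gt_eqF.
have -> : lambda * g * (1 + (lambda^-1 * h a - ln Z - ln g)) =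
  (h a - lambda * ln g) * g - lambda * (ln Z - 1) * g.
  by field; rewrite gt_eqF.
by rewrite lerBlDr.
Qed.

Lemma entropic_integral_le (g : X -> R) :
  measurable_fun D g -> (forall a, D a -> 0 <= g a) ->
  (\int[mu]_(a in D) (g a)%:E = 1)%E ->
  (\int[mu]_(a in D) ((h a - lambda * ln (g a)) * g a)%:E
    <= (lambda * ln Z)%:E)%E.
Proof.
move=> mg g0 g1.
have gint : mu.-integrable D (EFin \o g).
  apply/integrableP; split; first exact/measurable_EFinP.
  under eq_integral => a /[1!inE] Da.
    by rewrite gee0_abs ?lee_fin ?g0//=; over.
  by rewrite g1 ltry.
have qint := integrable_gibbs_density.
(* q and g both have integral 1, so the bound integrates to
   lambda + lambda * (ln Z - 1) = lambda * ln Z *)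
have -> : (lambda * ln Z)%:E = (\int[mu]_(a in D)
    (lambda%:E * (q a)%:E + (lambda * (ln Z - 1))%:E * (g a)%:E))%E.
  rewrite integralD//=; [|exact: integrableZl|exact: integrableZl].
  rewrite !integralZl// integral_gibbs_density g1 !mule1 -EFinD.
  by congr EFin; ring.
apply: le_integral_integrable_ub => //.
- apply/measurable_EFinP/measurable_funM => //; apply: measurable_funB => //.
  by apply: measurable_funM => //; apply: measurableT_comp => //.
- by apply: integrableD => //; exact: integrableZl.
- by move=> a Da; rewrite -!EFinM -EFinD lee_fin le_gibbs_density// g0.
Qed.

(** The integrand is [lambda ln Z * q], as [h - lambda ln q] is the constant
[lambda ln Z]. *)
Lemma entropic_integral_gibbs :
  (\int[mu]_(a in D) ((h a - lambda * ln (q a)) * q a)%:E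
    = (lambda * ln Z)%:E)%E.
Proof.
transitivity (\int[mu]_(a in D) ((lambda * ln Z)%:E * (q a)%:E))%E.
  apply: eq_integral => a _; rewrite -EFinM; congr EFin; congr (_ * _).
  rewrite ln_div ?posrE ?expR_gt0// expRK.
  by field; rewrite gt_eqF.
rewrite integralZl//; last exact: integrable_gibbs_density.
by rewrite integral_gibbs_density mule1.
Qed.

End gibbs_variational_principle.

(** * Positivity of Lebesgue measure on open sets *)

Section lebesgue_open.
Context {R : realType}.
Local Notation RR := (measurableTypeR R).

(** The box is a product of intervals of length [2 e] around the coordinates of
[c], built along the recursive definition of the measure; its measure is
[(2 e) ^ n]. *)
Lemma lebesgue_tuple_box_gt0 n (c : n.-tuple RR) (e : R) : 0 < e ->
  exists B : set (n.-tuple RR), [/\ measurable B, (0 < lebesgue_tuple n B)%E &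
    forall t, B t -> forall i, `|tnth c i - tnth t i| < e].
Proof.
move=> e0; elim: n c => [c|n IH c].
  exists setT; split => //; last by move=> t _ [].
  by rewrite /= diracT.
have [B [mB B0 Bc]] := IH [tuple of behead c].
pose A : set RR := `](thead c - e), (thead c + e)[%classic.
have mA : measurable A by exact: measurable_itv.
exists ((fun t : n.+1.-tuple RR => (thead t, [tuple of behead t])) @^-1` (A `*` B)).
split.
- rewrite -[X in measurable X]setTI.
  have : measurable_fun setT
      (fun t : n.+1.-tuple RR => (thead t, [tuple of behead t])).
    apply/measurable_fun_pairP; split; first exact: measurable_tnth.
    exact: measurable_behead.
  by apply => //; exact: measurableX.
- rewrite /= /lebesgue_cons /pushforward.
  (* pulled back to pairs, the box is a rectangle *)
  rewrite (_ : _ @^-1` _ = A `*` B); last first.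
    have tK (x : RR) (t : n.-tuple RR) :
        [tuple of behead (tuple_cons (x, t))] = t by exact: val_inj.
    by apply/seteqP; split => -[x t] /=; rewrite tK theadE.
  rewrite product_measure1E// mule_gt0//.
  (* both factors live on a retyped copy of the real line, hence the conversion *)
  rewrite -[X in (0 < X)%E]/(lebesgue_measure A) /A lebesgue_measure_itv/=.
  by rewrite lte_fin (_ : _ < _) -?EFinD ?lte_fin; lra.
- move=> t [/= tA tB] i.
  case: (unliftP ord0 i) => [j ->|->].
    have -> : lift ord0 j = inord j.+1 :> 'I_n.+1.
      by apply: val_inj; rewrite /= inordK// ltnS.
    by have := Bc _ tB j; rewrite !tnth_behead.
  move: tA; rewrite /A /= in_itv/= => /andP[t1 t2].
  by rewrite ltr_norml -/(thead c) -/(thead t); apply/andP; split; lra.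
Qed.

(** Balls for the sup norm of row vectors are boxes. *)
Lemma lebesgue_row_open_gt0 d (O : set 'rV[R]_d) :
  open O -> O !=set0 -> (0 < lebesgue_row R d O)%E.
Proof.
move=> oO [x Ox].
have /nbhs_ballP[e /= e0 xeO] := open_nbhs_nbhs (conj oO Ox).
have [B [mB B0 Bx]] := lebesgue_tuple_box_gt0 (tuple_of_row (x : borelV R d)) e0.
apply: (lt_le_trans B0); rewrite /lebesgue_row /pushforward.
apply: le_measure; rewrite ?inE//.
  rewrite -[X in measurable X]setTI; apply: measurable_row_of_tuple => //.
  exact: sub_sigma_algebra.
move=> t /Bx tx /=; apply: xeO; split => // i j; rewrite !mxE /ball/=.
by have := tx j; rewrite tnth_mktuple (ord1 i).
Qed.

End lebesgue_open.

(** * Relaxed controls and the Gibbs control *)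

Section relaxed_gibbs_control.
Context {R : realType} {d : nat}.
Variables (U : set 'rV[R]_d) (lambda : R).
Local Notation leb := (lebesgue_row R d).
Local Notation measurableU := (measurable (U : set (borelV R d))).

Lemma measurable_compact_domain : compact_domain U -> measurableU.
Proof.
move=> [_ [V [_ _ _ ->]]]; rewrite -[X in measurable X]setCK.
apply: measurableC; apply: sub_sigma_algebra.
by apply: closed_openC; exact: closed_closure.
Qed.

(** A compact domain is the closure of a nonempty open set. *)
Lemma lebesgue_compact_domain_gt0 : compact_domain U -> (0 < leb U)%E.
Proof.
move=> cU; have [_ [V [oV _ V0 UE]]] := cU.
apply: (lt_le_trans (lebesgue_row_open_gt0 oV V0)).
apply: le_measure; rewrite ?inE.
- exact: sub_sigma_algebra.
- exact: measurable_compact_domain.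
- by rewrite UE; exact: subset_closure.
Qed.

(** Preimages of open intervals are traces on [U] of open sets. *)
Lemma within_continuous_measurable_fun (f : 'rV[R]_d -> R) : measurableU ->
  {within U, continuous f} ->
  measurable_fun (U : set (borelV R d)) (f : borelV R d -> R).
Proof.
move=> mU cf.
apply: (@measurability _ _ _ _ _ _ _ (@RGenOpens.measurableE R)) => //.
move=> _ [_ [a [b ->]] <-].
have oI : open `]a, b[%classic by exact: interval_open.
have /continuousP/(_ _ oI)/open_subspaceP[V oV VU] := cf.
rewrite setIC -VU.
by apply: measurableI => //; exact: sub_sigma_algebra.
Qed.

(** Two densities of [gamma] have the same integral, namely the [gamma]-measure,
over every measurable subset of [U]. *)
Lemma has_density_ae_eq (gamma : probability (borelV R d) R)
    (g g' : borelV R d -> R) : measurableU ->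
  has_density U gamma g -> has_density U gamma g' ->
  ae_eq leb (U : set (borelV R d)) (EFin \o g) (EFin \o g').
Proof.
move=> mU [mg g0 gE] [mg' g'0 g'E]; apply: integral_ae_eq => //.
- apply/integrableP; split; first exact/measurable_EFinP.
  under eq_integral => a /[1!inE] Ua.
    by rewrite gee0_abs ?lee_fin ?g0//=; over.
  rewrite -[X in integral _ X _]setIid -gE//.
  by rewrite (le_lt_trans (probability_le1 _ _))// ltry.
- exact/measurable_EFinP.
- by move=> E EU mE; have := gE _ mE; rewrite (g'E _ mE) !setIidl// => <-.
Qed.

(** The entropic reward is defined with the chosen version [density U gamma];
any other version of the density gives the same value. *)
Lemma entropic_rewardE (gamma : probability (borelV R d) R)
    (g : borelV R d -> R) (h : 'rV[R]_d -> R) : measurableU ->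
  measurable_fun (U : set (borelV R d)) (h : borelV R d -> R) ->
  has_density U gamma g ->
  entropic_reward U lambda gamma h =
    (\int[leb]_(a in U) ((h a - lambda * ln (g a)) * g a)%:E)%E.
Proof.
move=> mU mh gP.
have dP : has_density U gamma (density U gamma).
  exact: (@xgetPex _ (cst 0) [set g | has_density U gamma g] (ex_intro _ g gP)).
have mint k : has_density U gamma k ->
    measurable_fun (U : set (borelV R d))
      (fun a => ((h a - lambda * ln (k a)) * k a)%:E).
  move=> [mk _ _]; apply/measurable_EFinP/measurable_funM => //.
  apply: measurable_funB => //; apply: measurable_funM => //.
  exact: measurableT_comp.
apply: ae_eq_integral => //; [exact: mint|exact: mint|].
apply: filterS (has_density_ae_eq mU dP gP) => a /= + Ua.
by move=> /(_ Ua)[->].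
Qed.

Variable h : 'rV[R]_d -> R.
Hypotheses (mU : measurableU) (lambda_gt0 : 0 < lambda).
Hypothesis mh : measurable_fun (U : set (borelV R d)) (h : borelV R d -> R).
Hypothesis h_int :
  leb.-integrable (U : set (borelV R d)) (fun a => (expR (lambda^-1 * h a))%:E).
Hypothesis U_gt0 : (0 < leb U)%E.

Lemma gibbs_partition_gt0 : 0 < \int[leb]_(a in U) expR (lambda^-1 * h a).
Proof.
rewrite fine_gt0// integral_gt0//=; last 2 first.
- by move: h_int => /integrableP[].
- by move=> a _; rewrite lte_fin expR_gt0.
by rewrite ltey_eq integrable_fin_num.
Qed.

Lemma exists_gibbs_control : exists gamma : probability (borelV R d) R,
  PU U gamma /\ has_density U gamma (gibbs U lambda h).
Proof.
have Z0 := gibbs_partition_gt0.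
have q1 := integral_gibbs_density mU h_int Z0.
have mq : measurable_fun (U : set (borelV R d)) (gibbs U lambda h).
  exact: measurable_gibbs_density.
have q0 a : U a -> 0 <= gibbs U lambda h a.
  by move=> _; rewrite ltW// divr_gt0// expR_gt0.
have [gamma gammaE] := exists_probability_density mU mq q0 q1.
exists gamma; split; last by split.
by rewrite /PU /= gammaE// setIid.
Qed.

(** The bound [entropic_integral_le] holds for every control with a density, and
the Gibbs density attains it by [entropic_integral_gibbs]. *)
Lemma opt_entropic_reward_gibbs (gamma : probability (borelV R d) R) :
  PU U gamma -> has_density U gamma (gibbs U lambda h) ->
  opt_entropic_reward U lambda h = entropic_reward U lambda gamma h /\
  opt_entropic_reward U lambda h =
    (lambda * ln (\int[leb]_(a in U) expR (lambda^-1 * h a)))%:E.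
Proof.
move=> gammaU gammaP; have Z0 := gibbs_partition_gt0.
have gammaE : entropic_reward U lambda gamma h =
    (lambda * ln (\int[leb]_(a in U) expR (lambda^-1 * h a)))%:E.
  by rewrite (entropic_rewardE mU mh gammaP) entropic_integral_gibbs.
suff -> : opt_entropic_reward U lambda h = entropic_reward U lambda gamma h.
  by split.
apply/eqP; rewrite eq_le; apply/andP; split; last first.
  apply: ereal_sup_ubound; exists gamma => //; split => //.
  by exists (gibbs U lambda h).
apply: ge_ereal_sup => _ [nu [nuU [g gP]] <-].
rewrite gammaE (entropic_rewardE mU mh gP).
have [mg g0 gE] := gP; apply: entropic_integral_le => //.
by rewrite -[X in integral _ X _]setIid -gE.
Qed.

End relaxed_gibbs_control.

(** * Regularity of the pre-Hamiltonian in the control *)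

Section Htilde_regularity.
Context {R : realType} {m d : nat}.
Variables (T : R) (U : set 'rV[R]_d) (lambda : R).
Variables (b : R -> 'rV[R]_m -> 'rV[R]_d -> 'rV[R]_m).
Variable (rew : R -> 'rV[R]_m -> 'rV[R]_d -> R).
Hypotheses (mU : measurable (U : set (borelV R d))) (lambda_gt0 : 0 < lambda).
Hypothesis hb : forall i, Cb_slab T U (fun t x u => b t x u 0 i).
Hypothesis hrew : normalizable_reward T U lambda rew.
Local Notation leb := (lebesgue_row R d).

Lemma Cb_slab_continuous (f : R -> 'rV[R]_m -> 'rV[R]_d -> R) (t : R) x :
  Cb_slab T U f -> t \in `[0, T] -> {within U, continuous (f t x)}.
Proof.
move=> [/subspace_continuousP cf _] tT; apply/subspace_continuousP => u Uu.
have slu : slab T U (t, x, u) by split.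
have tu : (fun u => (t, x, u)) @ within U (nbhs u) -->
    within (slab T U) (nbhs (t, x, u)).
  move=> A [[B C] /= [ntx nu] BCA]; apply: filterS nu => u' Cu' Uu'.
  by apply: (BCA (t, x, u')); [split=> //; exact: nbhs_singleton ntx|split].
exact: cvg_comp tu (cf _ slu).
Qed.

Lemma measurable_Htilde (t : R) y p : t \in `[0, T] ->
  measurable_fun (U : set (borelV R d))
    ((fun a => Htilde b rew t y a p) : borelV R d -> R).
Proof.
move=> tT; apply: measurable_funD; last by have [] := hrew y tT.
apply: measurable_sum => i; apply: measurable_funM => //.
apply: (@within_continuous_measurable_fun _ _ U (fun a => b t y a 0 i)) => //.
exact: (@Cb_slab_continuous (fun t x u => b t x u 0 i) t y (hb i) tT).
Qed.

(** As [b] is bounded, the weight at slope [p] is at most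
[exp (M / lambda) exp (rew / lambda)] with [M = \sum_i |p_i| sup |b_i|]. *)
Lemma integrable_exp_Htilde (t : R) y p : t \in `[0, T] ->
  leb.-integrable (U : set (borelV R d))
    (fun a => (expR (lambda^-1 * Htilde b rew t y a p))%:E).
Proof.
move=> tT; have [mr rlty] := hrew y tT.
have /choice[C CP] i := (hb i).2.
pose M := \sum_i `|p 0 i| * C i.
have mexp (k : borelV R d -> R) : measurable_fun (U : set (borelV R d)) k ->
    measurable_fun (U : set (borelV R d)) (fun a => (expR (lambda^-1 * k a))%:E).
  move=> mk; apply/measurable_EFinP; apply: measurableT_comp => //.
  exact: measurable_funM.
apply: (@le_integrable _ _ _ _ _ mU _
  (fun a => ((expR (lambda^-1 * M))%:E * (expR (lambda^-1 * rew t y a))%:E)%E)).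
- by apply: (mexp (fun a => Htilde b rew t y a p)); exact: measurable_Htilde.
- move=> a Ua; rewrite -EFinM -expRD -mulrDr !gee0_abs ?lee_fin ?expR_ge0//.
  rewrite ler_expR ler_pM2l ?invr_gt0// lerD2r ler_sum// => i _.
  by rewrite (le_trans (ler_norm _))// normrM ler_wpM2l// CP.
- apply: integrableZl => //; apply/integrableP; split; first exact: mexp.
  by under eq_integral do rewrite gee0_abs ?lee_fin ?expR_ge0//.
Qed.

End Htilde_regularity.

(** * The optimal feedback policy *)

Theorem proposition5p3 (R : realType) (m d : nat)
  (T alpha kappa lambda beta0 : R)
  (zeta : R -> 'rV[R]_d) (zeta2 : R -> R -> 'M[R]_d)
  (U : set 'rV[R]_d)
  (b : R -> 'rV[R]_m -> 'rV[R]_d -> 'rV[R]_m)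
  (sigma : R -> 'rV[R]_m -> 'M[R]_(m, d))
  (rew : R -> 'rV[R]_m -> 'rV[R]_d -> R)
  (G : 'rV[R]_m -> R)
  (K : set (probability (borelV R d) R))
  (dK : probability (borelV R d) R -> probability (borelV R d) R -> R)
  (v : R -> 'rV[R]_m -> R)
  (hT : 0 < T)
  (halpha : 3^-1 < alpha)
  (hkappa : 3^-1 < kappa < alpha)
  (hzeta : rough_noise T alpha zeta zeta2)
  (hU : compact_domain U)
  (hlambda : 0 < lambda)
  (hb : drift_assumption T U b)
  (hsigma : diffusion_assumption T sigma)
  (hbeta0 : 0 < beta0)
  (hK : K `<=` PU_ge U beta0)
  (hdK : is_metric_on K dK)
  (hF : reward_assumption T U lambda rew K dK)
  (hrew : normalizable_reward T U lambda rew)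
  (hG : terminal_assumption G)
  (hv : unique_rough_viscosity_solution T U lambda b sigma rew G alpha kappa
          zeta zeta2 v)
  (hgrad : forall (t : R) y, t \in `[0, T] -> differentiable (v t) y) :
  exists gamma_star : R -> 'rV[R]_m -> 'rV[R]_m -> probability (borelV R d) R,
    (forall (t : R) y p, t \in `[0, T] ->
       PU U (gamma_star t y p) /\
       has_density U (gamma_star t y p)
         (gibbs U lambda (fun a => Htilde b rew t y a p))) /\
    (forall (t : R) y, t \in `[0, T] ->
       let H := fun a => Htilde b rew t y a (grad (v t) y) in
       opt_entropic_reward U lambda H
         = entropic_reward U lambda (gamma_star t y (grad (v t) y)) H /\
       opt_entropic_reward U lambda H
         = (lambda * ln (\int[lebesgue_row R d]_(a in U)
                           expR (lambda^-1 * H a)))%:E).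
Proof.
have mU := measurable_compact_domain hU.
have U0 := lebesgue_compact_domain_gt0 hU.
have hb0 i : Cb_slab T U (fun t x u => b t x u 0 i).
  by have [/(_ i)[]] := hb.
(* a junk probability measure is used at times outside [0, T] *)
have exP (z : R * 'rV[R]_m * 'rV[R]_m) :
    exists gamma : probability (borelV R d) R, z.1.1 \in `[0, T] ->
    PU U gamma /\ has_density U gamma
      (gibbs U lambda (fun a => Htilde b rew z.1.1 z.1.2 a z.2)).
  have [tT|_] := boolP (z.1.1 \in `[0, T]); last by exists \d_(0 : borelV R d).
  have mH := measurable_Htilde mU hb0 hrew z.1.2 z.2 tT.
  have iH := integrable_exp_Htilde mU hlambda hb0 hrew z.1.2 z.2 tT.
  by have [gamma] := exists_gibbs_control mU mH iH U0; exists gamma.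
have [gamma_star gammaP] := choice exP.
exists (fun t y p => gamma_star (t, y, p)); split.
  by move=> t y p tT; exact: (gammaP (t, y, p)).
move=> t y tT; have [gU gD] := gammaP (t, y, grad (v t) y) tT.
apply: opt_entropic_reward_gibbs => //.
- exact: (measurable_Htilde mU hb0 hrew y (grad (v t) y) tT).
- exact: (integrable_exp_Htilde mU hlambda hb0 hrew y (grad (v t) y) tT).
Qed.
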